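(* Let $(X_i,\tau_i)_{i\in I}$ be a family of nonempty topological spaces. If the product space $X=\prod_{i\in I}X_i$ (with the product topology) is sg-compact, then either all factor spaces $X_i$ are finite, or exactly one of the factor spaces is infinite and sg-compact and all the remaining factor spaces are finite and locally indiscrete.
   Context: No separation axioms are assumed. A subset $A$ of a topological space is semi-open if $A\subseteq \mathrm{cl}(\mathrm{int}(A))$ and semi-closed if $\mathrm{int}(\mathrm{cl}(A))\subseteq A$. The semi-interior $\mathrm{sint}(A)$ of $A$ is the union of all semi-open subsets of $A$. A subset $A$ of a topological space is sg-open if every semi-closed subset $F\subseteq A$ satisfies $F\subseteq \mathrm{sint}(A)$. A topological space $X$ is sg-compact if every cover of $X$ by sg-open sets has a finite subcover. A topological space is locally indiscrete if every open subset is closed. *)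

(* Defs.v *)
From mathcomp Require Import all_boot all_classical.
From mathcomp Require Import topology.

Set Implicit Arguments.
Unset Strict Implicit.
Unset Printing Implicit Defensive.

Local Open Scope classical_set_scope.

Definition semi_open (T : topologicalType) (A : set T) : Prop :=
  A `<=` closure (interior A).

Definition semi_closed (T : topologicalType) (A : set T) : Prop :=
  interior (closure A) `<=` A.

Definition semi_interior (T : topologicalType) (A : set T) : set T :=
  \bigcup_(U in [set U : set T | semi_open U /\ U `<=` A]) U.

Definition sg_open (T : topologicalType) (A : set T) : Prop :=
  forall F : set T, semi_closed F -> F `<=` A -> F `<=` semi_interior A.

(* Covers are sets of subsets; [finite_subset_cover C id setT] says that some
   finite subset of C still covers T. *)
Definition sg_compact (T : topologicalType) : Prop :=
  forall C : set (set T),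
    (forall A, C A -> sg_open A) -> cover C id = [set: T] ->
    finite_subset_cover C id [set: T].

Definition locally_indiscrete (T : topologicalType) : Prop :=
  forall A : set T, open A -> closed A.

(* Main.v *)
(** A set A is sg-open iff each of its points x lies in cl(int A) or in
    int(cl{x}).  Hence in an sg-compact space a set A is finite as soon as all
    the sets ~(A \ {a}), for a in A, are sg-open: this applies to nowhere dense
    sets, and to the whole space when x is in int(cl{x}) for every x.

    Suppose X_i is infinite.  For a point x of the product, the closed set N of
    the y with y_k in cl{x_k} for all k <> i is infinite, hence has an interior
    point z.  Substituting z_i for the i-th coordinate maps x into the interior
    of N and preserves N, so x itself is interior to N.  Therefore
    x_j is in int(cl{x_j}) for all j <> i, which makes X_j locally indiscrete,
    and x is in int(cl{x}) whenever x_i is in int(cl{x_i}).  The latter makes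
    projections onto X_i pull sg-open sets back to sg-open sets, and shows that
    if some other X_j were infinite, the whole product would be finite. *)

Require Import Defs.
From mathcomp Require Import all_boot finmap all_classical.
From mathcomp Require Import topology.

Local Open Scope classical_set_scope.

Lemma sg_openP (T : topologicalType) (A : set T) :
  sg_open A <->
  forall x, A x -> closure A° x \/ (closure [set x])° x.
Proof.
split=> [sgA x Ax|Axy F scF FA x Fx].
  have [scx|nscx] := pselect (semi_closed [set x]).
    left; have [|U [soU UA] Ux] := sgA _ scx _ x erefl; first by move=> _ ->.
    by have := soU _ Ux; apply: closureS; exact: interiorS.
  (* A point [y] of int(cl{x}) lies in cl{x}, so this open neighbourhood of [y] must contain x
     itself. *)
  right; apply: contra_notP nscx => nx y cxy.
  case: nx.
  have /interior_subset := cxy.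
  by move=> /(_ _ (open_nbhs_nbhs (conj (@open_interior _ _) cxy))) [_ [->]].
have [clx|ox] := Axy _ (FA _ Fx).
  (* Semi-open, because its interior still contains int A. *)
  exists (A `&` closure A°); last by split=> //; exact: FA.
  split; last by move=> ? [].
  move=> y [_]; apply: closureS.
  rewrite -{1}(interior_id A°).1; last exact: open_interior.
  apply: interiorS => z zA; split; first exact: interior_subset.
  exact: subset_closure.
have xA : A° x.
  (* As x is in F and F is semi-closed, int(cl{x}) is inside int(cl F), hence inside F. *)
  have : (closure [set x])° `<=` A.
    apply: subset_trans FA; apply: subset_trans scF.
    by apply/interiorS/closureS => _ ->.
  by move=> /interiorS; apply; rewrite (interior_id _).1//; exact: open_interior.
exists A°; last by [].
split; last exact: interior_subset.
move=> y Ay; apply: subset_closure.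
by rewrite (interior_id _).1//; exact: open_interior.
Qed.

(** The set ~(A \ {a}) meets A only in a, so each member of a finite subcover accounts for one point
    of A. *)
Lemma sg_compact_finite (T : topologicalType) (A : set T) :
  sg_compact T -> (forall a, A a -> sg_open (~` (A `\ a))) -> finite_set A.
Proof.
move=> cT oA.
have [[a Aa]|/set0P/negP/negPn/eqP->//] := pselect (A !=set0).
pose C := [set ~` (A `\ a) | a in A].
have [||D DC covD] := cT C.
- by move=> _ [b Ab <-]; exact: oA.
- apply/seteqP; split=> // x _.
  have [Ax|nAx] := pselect (A x).
    by exists (~` (A `\ x)); [exists x|case=> _; apply].
  by exists (~` (A `\ a)); [exists a|case].
apply: (@sub_finite_set _ _ (\bigcup_(U in [set` D]) (A `&` U))).
  by move=> x Ax; have [U DU Ux] := covD x I; exists U.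
apply: bigcup_finite => [|U /DC]; first exact: finite_fset.
rewrite inE => -[b Ab <-]; apply: (@sub_finite_set _ _ [set b]) => //.
by move=> x [Ax nAx]; apply: contrapT => xb; exact: nAx.
Qed.

(** Each A \ {a} is again nowhere dense, so its complement has dense interior and is sg-open. *)
Lemma sg_compact_nowhere_dense_finite (T : topologicalType) (A : set T) :
  sg_compact T -> (closure A)° = set0 -> finite_set A.
Proof.
move=> cT A0; apply: sg_compact_finite => // a Aa; apply/sg_openP => x _; left.
rewrite interiorC closure_setC.
suff -> : (closure (A `\ a))° = set0 by rewrite setC0.
by rewrite -subset0 -A0; apply/interiorS/closureS => ? [].
Qed.

Lemma sg_compact_preopen_points_finite (T : topologicalType) :
  sg_compact T -> (forall x : T, (closure [set x])° x) -> finite_set [set: T].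
Proof.
by move=> cT pT; apply: sg_compact_finite => // a _; apply/sg_openP => x _; right.
Qed.

(** If y is in cl A with A open, then A meets the neighbourhood int(cl{y}) in some u; as u is in
    cl{y}, its neighbourhood A contains y. *)
Lemma preopen_points_locally_indiscrete (T : topologicalType) :
  (forall x : T, (closure [set x])° x) -> locally_indiscrete T.
Proof.
move=> pT A oA y /(_ _ (pT y)) [u [Au yu]].
by case: (yu A) => [|_ [->]] //; exact: open_nbhs_nbhs.
Qed.

Section Product.
Context {I : eqType} {X : I -> topologicalType}.
Implicit Types (i j : I) (x y z : prod_topology X).

Lemma proj_surj i : prod_topology X -> proj i @` [set: prod_topology X] = setT.
Proof.
move=> x; apply/seteqP; split=> // t _.
by exists (dfwith x i t) => //; rewrite /proj dfwithin.
Qed.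

Lemma cvg_prod_topology (F : set_system (prod_topology X)) z : Filter F ->
  (forall i, proj i @ F --> z i) -> F --> z.
Proof.
move=> FF Fz; apply/cvg_sup => i; apply/cvg_image.
  exact: proj_surj z.
move=> B /(Fz i) FB; exists (proj i @^-1` B) => //; apply: image_preimage.
exact: proj_surj z.
Qed.

Lemma closure_point_prod x y :
  (forall i, closure [set x i] (y i)) -> closure [set x] y.
Proof.
move=> xy B yB; exists x; split=> //.
have := @cvg_prod_topology (principal_filter x) y _; apply => // i A /(xy i).
by case=> _ [-> Ax] _ ->.
Qed.

Definition replace_coord i (t : X i) y : prod_topology X := dfwith y i t.

Lemma replace_coord_continuous i (t : X i) : continuous (replace_coord i t).
Proof.
move=> y; apply: cvg_prod_topology => [|j].
  by apply: fmap_filter; exact: nbhs_filter.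
change ((proj j \o replace_coord i t) @ nbhs y --> replace_coord i t y j).
rewrite /replace_coord; have [<-|ij] := eqVneq i j.
  rewrite dfwithin (_ : _ \o _ = cst t); last first.
    by apply: funext => z; rewrite /= /proj dfwithin.
  by apply: cvg_cst; exact: nbhs_filter.
rewrite dfwithout// (_ : _ \o _ = proj j); first exact: proj_continuous.
by apply: funext => z; rewrite /= /proj dfwithout.
Qed.

Lemma nbhs_slice i x (A : set (prod_topology X)) :
  nbhs x A -> nbhs (x i) (@dfwith I X x i @^-1` A).
Proof.
move=> xA; apply: dfwith_continuous.
suff -> : dfwith x i (x i) = x by [].
by apply: functional_extensionality_dep => k; case: dfwithP.
Qed.

Lemma closed_proj_preimage i (A : set (X i)) : closed A ->
  closed (proj i @^-1` A : set (prod_topology X)).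
Proof. by move=> cA; apply: closed_comp => // ? _; exact: proj_continuous. Qed.

Lemma interior_closure_off_coord i x :
  sg_compact (prod_topology X) -> infinite_set [set: X i] ->
  [set y : prod_topology X | forall k, k != i -> closure [set x k] (y k)]° x.
Proof.
move=> cX infX; set N := [set y | _].
have cN : closed N.
  have -> : N = \bigcap_(k in [set k | k != i]) (proj k @^-1` closure [set x k]).
    by apply/seteqP; split.
  by apply: closed_bigI => k _; apply: closed_proj_preimage; exact: closed_closure.
have infN : infinite_set N.
  move=> finN; apply: infX.
  apply: sub_finite_set (finite_image (proj i) finN) => t _.
  exists (dfwith x i t); last by rewrite /proj dfwithin.
  by move=> k ki; rewrite dfwithout 1?eq_sym//; exact: subset_closure.
have [z Nz] : N° !=set0.
  apply/set0P/eqP => N0; apply: infN.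
  apply: sg_compact_nowhere_dense_finite => //.
  by rewrite -(closure_id N).1.
(* Both points agree at [i], and elsewhere z_k is in cl{x_k} because z is in N. *)
have zx : closure [set replace_coord i (z i) x] z.
  apply: closure_point_prod => k.
  rewrite /replace_coord; case: dfwithP => [|k' ik']; first exact: subset_closure.
  by apply: (interior_subset Nz); rewrite eq_sym.
have [_ [-> xN]] : [set replace_coord i (z i) x] `&` N° !=set0.
  by apply/zx/open_nbhs_nbhs; split => //; exact: open_interior.
(* N does not constrain coordinate [i], so this preimage is N itself. *)
have : nbhs x (replace_coord i (z i) @^-1` N).
  exact: replace_coord_continuous xN.
apply: filterS => y Ny k ki.
by have := Ny _ ki; rewrite /replace_coord dfwithout// eq_sym.
Qed.

Lemma preopen_other_coord i j x :
  sg_compact (prod_topology X) -> infinite_set [set: X i] -> j != i ->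
  (closure [set x j])° (x j).
Proof.
move=> cX infX ji; have := interior_closure_off_coord i x cX infX.
by move/(nbhs_slice j); apply: filterS => t /(_ _ ji); rewrite dfwithin.
Qed.

Lemma preopen_point_prod i x :
  sg_compact (prod_topology X) -> infinite_set [set: X i] ->
  (closure [set x i])° (x i) -> (closure [set x])° x.
Proof.
move=> cX infX xi.
have nxi : nbhs x (proj i @^-1` closure [set x i]) by exact: proj_continuous xi.
have := conj nxi (interior_closure_off_coord i x cX infX).
rewrite -[_ /\ _]/((_° `&` _°) x) -interiorI; apply: interiorS => y [yi yk].
by apply: closure_point_prod => k; have [->|/yk] := eqVneq k i.
Qed.

Lemma sg_open_proj_preimage i (A : set (X i)) :
  sg_compact (prod_topology X) -> infinite_set [set: X i] -> sg_open A ->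
  sg_open (proj i @^-1` A : set (prod_topology X)).
Proof.
move=> cX infX /sg_openP oA; apply/sg_openP => x /oA [clx|xi]; last first.
  by right; exact: preopen_point_prod xi.
left=> B /(nbhs_slice i) /clx [t [At Bt]].
(* The slice of B through x is a neighbourhood of x_i, hence meets int A at [t]; moving x along the
   slice to [t] stays in B. *)
exists (dfwith x i t); split=> //.
by apply: (@proj_continuous _ X i); rewrite /= /proj dfwithin.
Qed.

Lemma sg_compact_infinite_coord i : prod_topology X ->
  sg_compact (prod_topology X) -> infinite_set [set: X i] -> sg_compact (X i).
Proof.
move=> x cX infX C oC covC.
have [||D DC covD] := cX [set proj i @^-1` U | U in C].
- by move=> _ [U CU <-]; exact/sg_open_proj_preimage/oC.
- apply/seteqP; split=> // y _; have : cover C id (y i) by rewrite covC.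
  by move=> [U CU Uy]; exists (proj i @^-1` U) => //; exists U.
exists [fset (proj i @` V)%classic | V in D]%fset.
  move=> _ /imfsetP [V /= /DC + ->]; rewrite !inE => -[U CU <-].
  by rewrite image_preimage//; exact: proj_surj.
move=> t _; have [V DV Vt] := covD (dfwith x i t) Logic.I.
exists (proj i @` V); first exact: in_imfset.
by exists (dfwith x i t) => //; rewrite /proj dfwithin.
Qed.

Lemma finite_other_coord i j : prod_topology X ->
  sg_compact (prod_topology X) -> infinite_set [set: X i] -> j != i ->
  finite_set [set: X j].
Proof.
move=> x cX infXi ji; apply: contrapT => infXj; apply: (infXi).
rewrite -(proj_surj i x); apply/finite_image/sg_compact_preopen_points_finite => //.
(* The two infinite factors play different roles: X_i infinite gives y_j in int(cl{y_j}), and X_j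
   infinite lifts this to y. *)
move=> y; apply: (preopen_point_prod j) => //.
exact: (preopen_other_coord i j y).
Qed.

Lemma locally_indiscrete_other_coord i j : prod_topology X ->
  sg_compact (prod_topology X) -> infinite_set [set: X i] -> j != i ->
  locally_indiscrete (X j).
Proof.
move=> x cX infX ji; apply: preopen_points_locally_indiscrete => t.
by have := preopen_other_coord i j (dfwith x j t) cX infX ji; rewrite dfwithin.
Qed.

End Product.

Theorem theorem2p4 (I : Type) (X : I -> topologicalType)
    (X_nonempty : forall i, [set: X i] !=set0)
    (X_sg_compact : sg_compact (prod_topology X)) :
  (forall i, finite_set [set: X i]) \/
  (exists i, [/\ infinite_set [set: X i],
                 sg_compact (X i) &
                 forall j, j <> i ->
                   finite_set [set: X j] /\ locally_indiscrete (X j)]).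
Proof.
have [?|/existsNP [i infX]] := pselect (forall i, finite_set [set: X i]).
  by left.
pose x : prod_topology X := fun k => sval (cid (X_nonempty k)).
right; exists i; split => //.
  (* Substituting a coordinate compares indices, so [I] is given classical decidable equality. *)
  exact: (@sg_compact_infinite_coord {classic I}).
move=> j nji; have ji : (j : {classic I}) != i by exact/eqP.
split.
  exact: (@finite_other_coord {classic I} X i j).
exact: (@locally_indiscrete_other_coord {classic I} X i j).
Qed.
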